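(* Let $m,n\ge 1$ be integers, $d=m+n\ge 3$, and let $\Theta$ be a real $n\times m$ matrix. For each integer $p$ with $1\le p\le d-2$ the following hold. If $p\ge m$, then \[(d-p-1)(1+\mathfrak a_{p+1})\ge (d-p)(1+\mathfrak a_p).\] If $p\le m-1$, then \[(d-p-1)(1+\mathfrak a_p)^{-1}\ge (d-p)(1+\mathfrak a_{p+1})^{-1}-n.\]
   Context: Let $\vec e_1,\dots,\vec e_d$ be the standard basis of $\mathbb R^d$ and let $\pmb\ell_1,\dots,\pmb\ell_d$ be the columns of the $d\times d$ matrix $\begin{pmatrix}E_m&-\Theta^{\top}\\ \Theta&E_n\end{pmatrix}$, where $E_k$ is the $k\times k$ identity matrix. For each $q$, the space $\wedge^q(\mathbb R^d)$ is regarded as a Euclidean space with orthonormal basis $\vec e_{i_1}\wedge\dots\wedge\vec e_{i_q}$, $1\le i_1<\dots<i_q\le d$, and $|\cdot|$ denotes the sup-norm of the coordinates in this basis. The lattice $\wedge^p(\mathbb Z^d)$ consists of integer combinations of these basis multivectors. For $\sigma=\{i_1<\dots<i_k\}\subseteq\{1,\dots,d\}$ put $\vec L_\sigma=\pmb\ell_{i_1}\wedge\dots\wedge\pmb\ell_{i_k}$, with $\vec L_\varnothing=1$. Let $\mathcal J_k$ be the set of $k$-element subsets of $\{1,\dots,m\}$. For $1\le p\le d-1$ put $k_0=\max(0,m-p)$. The regular (resp. uniform) $p$-th Diophantine exponent of the second type $\mathfrak b_p$ (resp. $\mathfrak a_p$) of $\Theta$ is the supremum of the real numbers $\gamma$ with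 the following property: there are arbitrarily large $t$ for which (resp. for every sufficiently large $t$) the system \[\max_{\sigma\in\mathcal J_k}|\vec L_\sigma\wedge\vec Z|\le t^{1-(k-k_0)(1+\gamma)},\qquad k=0,\dots,m,\] has a nonzero solution $\vec Z\in\wedge^p(\mathbb Z^d)$. *)

(* Defs.v *)
From mathcomp Require Import all_boot all_order all_algebra.
From mathcomp Require Import all_classical all_reals all_analysis.

Set Implicit Arguments.
Unset Strict Implicit.
Unset Printing Implicit Defensive.

Import Order.TTheory GRing.Theory Num.Theory.
Import numFieldNormedType.Exports.

Local Open Scope classical_set_scope.
Local Open Scope ring_scope.

(* An element of the exterior algebra of R^d, given by its coordinates: the
   coordinate at S = {i_1 < ... < i_q} is the coefficient of
   e_{i_1} /\ ... /\ e_{i_q}. The q-th exterior power is the set of the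
   multivectors satisfying [homogeneous q]. *)
Notation multivector R d := {ffun {set 'I_d} -> R}.

Section ExteriorAlgebra.
Variables (R : realType) (d : nat).
Implicit Types (x y : multivector R d) (A B S : {set 'I_d}).

Definition homogeneous (q : nat) x : Prop := forall S, #|S| != q -> x S = 0.

Definition inversions A B : nat :=
  #|[set ij : 'I_d * 'I_d | [&& ij.1 \in A, ij.2 \in B & (ij.2 < ij.1)%N]]%SET|.

(* For disjoint A and B, with the factors in increasing order inside each of
   them, e_A /\ e_B = (-1)^(inversions A B) e_(A :|: B). *)
Definition wedge x y : multivector R d :=
  [ffun S => \sum_(A in powerset S)
     (-1) ^+ inversions A (S :\: A) * x A * y (S :\: A)].

Definition mv1 : multivector R d := [ffun S => (S == finset.set0)%:R].

Definition mv_of_vec (v : 'cV[R]_d) : multivector R d :=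
  [ffun S => \sum_(i | S == [set i]%SET) v i 0].

Definition supnorm x : R := \big[Num.max/0]_S `|x S|.

Definition integral_multivector (q : nat) x : Prop :=
  homogeneous q x /\ forall S, x S \is a Num.int.

End ExteriorAlgebra.

Section Exponents.
Variables (R : realType) (m n : nat) (Theta : 'M[R]_(n, m)).

Definition ell_mx : 'M[R]_(m + n) :=
  block_mx 1%:M (- Theta^T) Theta 1%:M.

(* [enum sigma] lists sigma in increasing order. *)
Definition Lvec (sigma : {set 'I_(m + n)}) : multivector R (m + n) :=
  \big[@wedge R (m + n)/mv1 R (m + n)]_(i <- enum sigma)
     mv_of_vec (col i ell_mx).

Definition J (k : nat) : {set {set 'I_(m + n)}} :=
  [set sigma : {set 'I_(m + n)} |
     (#|sigma| == k) && [forall i in sigma, (i < m)%N]]%SET.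

(* The exponent bound uses k_0 = max(0, m - p), which is the truncated
   difference (m - p)%N. *)
Definition second_type_solvable (p : nat) (gamma t : R) : Prop :=
  exists Z : multivector R (m + n),
    [/\ integral_multivector p Z, Z != 0 &
        forall k : nat, (k <= m)%N ->
          \big[Num.max/0]_(sigma in J k) supnorm (wedge (Lvec sigma) Z)
          <= t `^ (1 - (k%:R - (m - p)%N%:R) * (1 + gamma))].

(* The uniform exponent of the second type; it may be +oo. *)
Definition exp_a (p : nat) : \bar R :=
  ereal_sup [set gamma%:E | gamma in
    [set gamma : R | \forall t \near +oo, second_type_solvable p gamma t]].

End Exponents.

(* Main.v *)
(** Put T = t^(1 + gamma) and W(Z) = max_sigma T^|sigma| |L_sigma /\ Z|, so that
    the system says W(Z) <= T^(1 / (1 + gamma) + k_0). If c = ell^-1 v are the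
    coordinates of v in the basis (ell_j), and N(v) is the largest of |c_j| / T
    for j <= m and of |c_j| for j > m, then W(v /\ Z) << W(Z) N(v). Hermite
    reduction yields a basis b_1, ..., b_d of Z^d with prod_i N(b_i) << T^(-m).

    Let Z have degree p and q = d - p. Some q of these vectors, indexed by I,
    wedge with Z to a nonzero integer, so 1 << W(Z) prod_I N(b_i). Drop from I
    the index with the smallest N, and let Y be the wedge of the p + 1 vectors
    outside the remaining set I'. Then W(Y) prod_I' N(b_i) << 1, whence
    W(Y)^q << W(Z)^(q - 1), which is the comparison of the exponents. *)

Require Import Defs.
From mathcomp Require Import all_boot all_order all_fingroup all_algebra.
From mathcomp Require Import all_classical all_reals all_analysis.
From mathcomp Require Import ring lra zify.

Set Implicit Arguments.
Unset Strict Implicit.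
Unset Printing Implicit Defensive.

Import Order.TTheory GRing.Theory Num.Theory.
Import numFieldNormedType.Exports.
Local Open Scope ring_scope.

(** * The exterior algebra in coordinates: signs, wedge product, sup-norm *)

Section ExteriorAlgebraTheory.
Variables (R : realType) (d : nat).
Implicit Types (x y z : multivector R d) (A B C S : {set 'I_d}) (v w : 'cV[R]_d).

Lemma inversionsUl A B C : [disjoint A & B] ->
  inversions (A :|: B) C = (inversions A C + inversions B C)%N.
Proof.
move=> dAB; rewrite /inversions -cardsUI.
have -> : ([set ij | [&& ij.1 \in A, ij.2 \in C & (ij.2 < ij.1)%N]] :&:
  [set ij | [&& ij.1 \in B, ij.2 \in C & (ij.2 < ij.1)%N]])%SET = finset.set0.
  apply/setP => -[i j]; rewrite !inE /=; apply/negP => /andP[/andP[iA _] /andP[iB _]].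
  by move/disjoint_setI0/setP/(_ i): dAB; rewrite !inE iA iB.
rewrite cards0 addn0; congr #|pred_of_set _|; apply/setP => -[i j].
by rewrite !inE /= andb_orl.
Qed.

Lemma inversionsUr A B C : [disjoint B & C] ->
  inversions A (B :|: C) = (inversions A B + inversions A C)%N.
Proof.
move=> dBC; rewrite /inversions -cardsUI.
have -> : ([set ij | [&& ij.1 \in A, ij.2 \in B & (ij.2 < ij.1)%N]] :&:
  [set ij | [&& ij.1 \in A, ij.2 \in C & (ij.2 < ij.1)%N]])%SET = finset.set0.
  apply/setP => -[i j]; rewrite !inE /=.
  apply/negP => /andP[/and3P[_ jB _] /and3P[_ jC _]].
  by move/disjoint_setI0/setP/(_ j): dBC; rewrite !inE jB jC.
rewrite cards0 addn0; congr #|pred_of_set _|; apply/setP => -[i j].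
by rewrite !inE /= -andb_orr andb_orl.
Qed.

(** Since A and B are disjoint, each pair in A x B is out of order in exactly one of the two
    arrangements. This is the source of the sign in anticommutativity. *)
Lemma inversions_swap A B : [disjoint A & B] ->
  (inversions A B + inversions B A = #|A| * #|B|)%N.
Proof.
move=> dAB; rewrite -cardsX.
have -> : inversions B A =
  #|[set ij : 'I_d * 'I_d | [&& ij.1 \in A, ij.2 \in B & (ij.1 < ij.2)%N]]%SET|.
  have swapI : injective (fun ij : 'I_d * 'I_d => (ij.2, ij.1)).
    by move=> [i j] [k l] [-> ->].
  rewrite /inversions -(card_imset _ swapI).
  congr #|pred_of_set _|; apply/setP => -[i j]; rewrite !inE /=.
  apply/imsetP/idP => [[[k l]] /= | /and3P[iA jB ij]].
    by rewrite inE /= => /and3P[kB lA lk] [-> ->]; rewrite lA kB lk.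
  by exists (j, i) => //; rewrite inE /= iA jB.
rewrite /inversions -cardsUI.
set I := (_ :&: _)%SET; have -> : I = finset.set0.
  apply/setP => -[i j]; rewrite !inE /=.
  by apply/negP => /andP[/and3P[_ _ ij] /and3P[_ _ ji]]; rewrite ltnNge ltnW in ij.
rewrite cards0 addn0; congr #|pred_of_set _|; apply/setP => -[i j].
rewrite !inE /= -!andb_orr.
have [iA|//] := boolP (i \in A); have [jB|//] := boolP (j \in B).
rewrite -neq_ltn; apply: contraTneq iA => /val_inj eji; rewrite -eji.
by apply/negP => jA; move/disjoint_setI0/setP/(_ j): dAB; rewrite !inE jA jB.
Qed.

Lemma wedgeE x y S : wedge x y S =
  \sum_(A : {set 'I_d} | A \subset S) (-1) ^+ inversions A (S :\: A) * x A * y (S :\: A).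
Proof. by rewrite ffunE; apply: eq_bigl => A; rewrite inE. Qed.

(** Both sides are sums over the splittings of S into three blocks A, B and the rest, matched by D =
    A :|: B. The signs agree because inversions are additive in each argument over disjoint
    unions. *)
Lemma wedgeA x y z : wedge x (wedge y z) = wedge (wedge x y) z.
Proof.
apply/ffunP => S; rewrite !wedgeE.
transitivity (\sum_(A : {set 'I_d} | A \subset S)
   \sum_(D : {set 'I_d} | (D \subset S) && (A \subset D))
   (-1) ^+ inversions D (S :\: D) *
   ((-1) ^+ inversions A (D :\: A) * x A * y (D :\: A)) * z (S :\: D)); last first.
  rewrite (exchange_big_dep (fun D : {set 'I_d} => D \subset S)) /=;
    last by move=> A D _ /andP[].
  apply: eq_bigr => D DS; rewrite wedgeE mulr_sumr mulr_suml.
  apply: eq_bigl => A; rewrite DS /=; apply/andP/idP => [[]//|AD].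
  by rewrite (fintype.subset_trans AD DS).
apply: eq_bigr => A AS; rewrite wedgeE mulr_sumr.
rewrite [RHS](reindex_onto (fun B => A :|: B) (fun D => D :\: A)) /=; last first.
  move=> D /andP[DS AD]; apply/setP => i; rewrite !inE.
  by case: (boolP (i \in A)) => // /(fintype.subsetP AD).
apply: eq_big => [B | B].
  rewrite finset.subUset AS finset.subsetUl finset.setDUl finset.setDv finset.set0U.
  by rewrite andbT finset.subsetD (sameP eqP finset.setDidPl).
rewrite finset.subsetD => /andP[BS dBA].
have -> : ((A :|: B) :\: A = B)%SET.
  by rewrite finset.setDUl finset.setDv finset.set0U; apply/finset.setDidPl.
have -> : (S :\: (A :|: B) = S :\: A :\: B)%SET by rewrite finset.setDDl.
have -> : inversions A (S :\: A) = (inversions A B + inversions A (S :\: A :\: B))%N.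
  rewrite -inversionsUr; last by rewrite disjoint_sym finset.disjoints_subset finset.subsetDr.
  congr (inversions A _); apply/setP => i; rewrite !inE.
  have [iB|//] := boolP (i \in B); rewrite (fintype.subsetP BS) // andbT /=.
  by apply/negP => iA; move/disjoint_setI0/setP/(_ i): dBA; rewrite !inE iA iB.
rewrite inversionsUl; last by rewrite disjoint_sym.
rewrite !exprD; ring.
Qed.

Lemma wedge_suml I (r : seq I) (P : pred I) (F : I -> multivector R d) y :
  wedge (\sum_(i <- r | P i) F i) y = \sum_(i <- r | P i) wedge (F i) y.
Proof.
apply/ffunP => S; rewrite wedgeE sum_ffunE.
under eq_bigr do rewrite sum_ffunE mulr_sumr mulr_suml.
by rewrite exchange_big; apply: eq_bigr => i _; rewrite wedgeE.
Qed.

Lemma wedge_sumr I (r : seq I) (P : pred I) x (F : I -> multivector R d) :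
  wedge x (\sum_(i <- r | P i) F i) = \sum_(i <- r | P i) wedge x (F i).
Proof.
apply/ffunP => S; rewrite wedgeE sum_ffunE.
under eq_bigr do rewrite sum_ffunE mulr_sumr.
by rewrite exchange_big; apply: eq_bigr => i _; rewrite wedgeE.
Qed.

Lemma wedgeZl a x y : wedge (a *: x) y = a *: wedge x y.
Proof.
apply/ffunP => S; rewrite wedgeE [RHS]ffunE wedgeE scaler_sumr.
by apply: eq_bigr => A _; rewrite ffunE /GRing.scale /=; ring.
Qed.

Lemma wedgeZr a x y : wedge x (a *: y) = a *: wedge x y.
Proof.
apply/ffunP => S; rewrite wedgeE [RHS]ffunE wedgeE scaler_sumr.
by apply: eq_bigr => A _; rewrite ffunE /GRing.scale /=; ring.
Qed.

Lemma wedge0l y : wedge 0 y = 0.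
Proof. by have := wedge_suml [::] xpredT (fun i : nat => 0) y; rewrite !big_nil. Qed.

Lemma wedge0r x : wedge x 0 = 0.
Proof. by have := wedge_sumr [::] xpredT x (fun i : nat => 0); rewrite !big_nil. Qed.

Lemma wedge1l y : wedge (mv1 R d) y = y.
Proof.
apply/ffunP => S; rewrite wedgeE (bigD1 finset.set0) ?finset.sub0set //= big1 ?addr0.
  rewrite ffunE eqxx finset.setD0 mulr1.
  suff -> : inversions finset.set0 S = 0%N by rewrite mul1r.
  by apply: eq_card0 => ij; rewrite !inE.
by move=> A /andP[_ /negPf A0]; rewrite ffunE A0 mulr0 mul0r.
Qed.

Lemma homogeneous_mv_of_vec v : homogeneous 1 (mv_of_vec v).
Proof.
move=> S S1; rewrite ffunE big1 // => i /eqP E.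
by rewrite E cards1 in S1.
Qed.

Lemma homogeneous_mv1 : homogeneous 0 (mv1 R d).
Proof. by move=> S; rewrite cards_eq0 ffunE => /negPf ->. Qed.

Lemma homogeneous_wedge p q x y :
  homogeneous p x -> homogeneous q y -> homogeneous (p + q) (wedge x y).
Proof.
move=> hx hy S Spq; rewrite wedgeE big1 // => A AS.
have [Ap|/hx->] := eqVneq #|A| p; last by rewrite mulr0 mul0r.
rewrite hy ?mulr0 //; apply: contraNneq Spq => <-.
by rewrite -Ap -(cardsID A S) (finset.setIidPr AS).
Qed.

Lemma wedge_int x y : (forall S, x S \is a Num.int) ->
  (forall S, y S \is a Num.int) -> forall S, wedge x y S \is a Num.int.
Proof.
move=> xI yI S; rewrite wedgeE rpred_sum // => A _.
by rewrite !rpredM // rpredX // rpredN rpred1.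
Qed.

Lemma mv_of_vec_int v : (forall i, v i 0 \is a Num.int) ->
  forall S, mv_of_vec v S \is a Num.int.
Proof. by move=> vI S; rewrite ffunE rpred_sum. Qed.

Lemma mv1_int S : mv1 R d S \is a Num.int.
Proof. by rewrite ffunE; case: eqP. Qed.

(** The complement A |-> S :\: A matches the terms of the two sides. Only splittings into two
    singletons contribute, and then the two inversion numbers add up to 1, so the signs are
    opposite. *)
Lemma vec_wedge_anti v w :
  wedge (mv_of_vec v) (mv_of_vec w) = - wedge (mv_of_vec w) (mv_of_vec v).
Proof.
apply/ffunP => S; rewrite !ffunE -sumrN.
under eq_bigl do rewrite inE; under [RHS]eq_bigl do rewrite inE.
rewrite [RHS](reindex_onto (fun A => S :\: A) (fun A => S :\: A)) /=; last first.
  by move=> A AS; rewrite finset.setDDr finset.setDv finset.set0U; apply/finset.setIidPr.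
apply: eq_big => [A|A AS].
  rewrite finset.subsetDl /= finset.setDDr finset.setDv finset.set0U.
  by apply/idP/eqP => /finset.setIidPr.
rewrite finset.setDDr finset.setDv finset.set0U (finset.setIidPr AS).
have [A1|A1] := eqVneq #|A| 1%N; last first.
  by rewrite (homogeneous_mv_of_vec _ A1) !(mulr0, mul0r, oppr0).
have [B1|B1] := eqVneq #|S :\: A| 1%N; last first.
  by rewrite !(homogeneous_mv_of_vec _ B1) !(mulr0, mul0r, oppr0).
have := @inversions_swap A (S :\: A).
rewrite disjoint_sym finset.disjoints_subset finset.subsetDr A1 B1 muln1 => /(_ isT) E.
have -> : (-1) ^+ inversions (S :\: A) A = - (-1) ^+ inversions A (S :\: A) :> R.
  case: (inversions A _) (inversions _ A) E => [|[|a]] b.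
  - by rewrite add0n => ->; rewrite expr0 expr1.
  - by rewrite add1n => -[->]; rewrite expr0 expr1 opprK.
  - by rewrite addSn.
ring.
Qed.

Lemma vec_wedge_vec v : wedge (mv_of_vec v) (mv_of_vec v) = 0.
Proof.
apply/ffunP => S; rewrite [RHS]ffunE.
have /ffunP/(_ S) := vec_wedge_anti v v; rewrite [X in _ = X]ffunE => E.
have : wedge (mv_of_vec v) (mv_of_vec v) S *+ 2 = 0 by rewrite mulr2n {1}E addNr.
by move/eqP; rewrite mulrn_eq0 /= => /eqP.
Qed.

Lemma mv_of_vec_mulmx (B : 'M[R]_d) v :
  mv_of_vec (B *m v) = \sum_j v j 0 *: mv_of_vec (col j B).
Proof.
apply/ffunP => S; rewrite sum_ffunE ffunE.
under [RHS]eq_bigr => j _ do rewrite !ffunE scaler_sumr.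
rewrite exchange_big; apply: eq_bigr => i _; rewrite mxE.
by apply: eq_bigr => j _; rewrite mxE /GRing.scale /= mulrC.
Qed.

Lemma supnorm_ge x S : `|x S| <= supnorm x.
Proof. by rewrite /supnorm; apply: (le_bigmax _ (fun S => `|x S|)). Qed.

Lemma supnorm_ge0 x : 0 <= supnorm x.
Proof. exact: le_trans (normr_ge0 _) (supnorm_ge x finset.set0). Qed.

Lemma supnorm_le x c : 0 <= c -> (forall S, `|x S| <= c) -> supnorm x <= c.
Proof. by move=> c0 xc; apply: bigmax_le. Qed.

Lemma supnorm0 : supnorm (0 : multivector R d) = 0.
Proof.
apply/eqP; rewrite eq_le supnorm_ge0 andbT.
by apply: supnorm_le => // S; rewrite ffunE normr0.
Qed.

Lemma supnormZ_le a x : supnorm (a *: x) <= `|a| * supnorm x.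
Proof.
apply: supnorm_le => [|S]; first by rewrite mulr_ge0 ?supnorm_ge0.
by rewrite ffunE normrM ler_wpM2l ?supnorm_ge.
Qed.

Lemma supnorm_sum_le I (r : seq I) (P : pred I) (F : I -> multivector R d) :
  supnorm (\sum_(i <- r | P i) F i) <= \sum_(i <- r | P i) supnorm (F i).
Proof.
apply: supnorm_le => [|S]; first by apply: sumr_ge0 => i _; apply: supnorm_ge0.
rewrite sum_ffunE (le_trans (ler_norm_sum _ _ _)) // ler_sum // => i _.
exact: supnorm_ge.
Qed.

Lemma supnorm_sign (b : bool) x : supnorm ((-1) ^+ b *: x) = supnorm x.
Proof.
apply: eq_bigr => S _; rewrite ffunE normrM.
by case: b; rewrite ?expr1 ?expr0 ?normrN ?normr1 mul1r.
Qed.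

(** Each coordinate of the product is a signed sum over the subsets of S, of which there are at most
    2^d. *)
Lemma supnorm_wedge_le x y :
  supnorm (wedge x y) <= (2 ^ d)%:R * supnorm x * supnorm y.
Proof.
apply: supnorm_le => [|S]; first by rewrite !mulr_ge0 ?supnorm_ge0.
rewrite ffunE (le_trans (ler_norm_sum _ _ _)) //.
apply: (@le_trans _ _ (\sum_(A in powerset S) supnorm x * supnorm y)).
  apply: ler_sum => A _; rewrite !normrM normrX normrN1 expr1n mul1r.
  by apply: ler_pM => //; apply: supnorm_ge.
rewrite sumr_const card_powerset -[leLHS]mulr_natl mulrA.
rewrite ler_wpM2r ?supnorm_ge0 // ler_wpM2r ?supnorm_ge0 // ler_nat.
by rewrite leq_exp2l // -[X in (_ <= X)%N](card_ord d) max_card.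
Qed.

Lemma supnorm_int_ge1 x : (forall S, x S \is a Num.int) -> x != 0 -> 1 <= supnorm x.
Proof.
move=> xI x0; have [S xS] : exists S, x S != 0.
  apply/existsP; apply: contraNT x0; rewrite negb_exists => /forallP xN.
  by apply/eqP/ffunP => S; rewrite ffunE; apply/eqP; rewrite -[_ == _]negbK.
by apply: le_trans (supnorm_ge x S); apply: norm_intr_ge1.
Qed.

End ExteriorAlgebraTheory.

(** * Iterated wedges with the columns of a matrix *)

Section WedgeCols.
Variables (R : realType) (d : nat).
Implicit Types (B : 'M[R]_d) (Z : multivector R d) (s : seq 'I_d) (v w : 'cV[R]_d).

(** The indices form a sequence, not a set, so that a column can be split off or moved at the cost
    of a sign. *)
Definition wedge_cols (B : 'M[R]_d) s Z : multivector R d :=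
  foldr (fun i => wedge (mv_of_vec (col i B))) Z s.

Lemma wedge_cols_cat B s1 s2 Z :
  wedge_cols B (s1 ++ s2) Z = wedge_cols B s1 (wedge_cols B s2 Z).
Proof. exact: foldr_cat. Qed.

Lemma wedge_bigE B s Z :
  wedge (\big[@wedge R d/mv1 R d]_(i <- s) mv_of_vec (col i B)) Z = wedge_cols B s Z.
Proof.
elim: s => [|i s IHs]; first by rewrite big_nil wedge1l.
by rewrite big_cons -wedgeA IHs.
Qed.

Lemma wedge_cols0 B s : wedge_cols B s 0 = 0.
Proof. by elim: s => //= i s ->; rewrite wedge0r. Qed.

Lemma wedge_vec_anti v w Z :
  wedge (mv_of_vec v) (wedge (mv_of_vec w) Z) =
  - wedge (mv_of_vec w) (wedge (mv_of_vec v) Z).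
Proof. by rewrite !wedgeA vec_wedge_anti -scaleN1r wedgeZl scaleN1r. Qed.

Lemma wedge_cols_vec B s v Z : wedge_cols B s (wedge (mv_of_vec v) Z) =
  (-1) ^+ size s *: wedge (mv_of_vec v) (wedge_cols B s Z).
Proof.
elim: s => [|i s IHs] /=; first by rewrite expr0 scale1r.
by rewrite IHs wedgeZr wedge_vec_anti scalerN exprS mulN1r scaleNr.
Qed.

(** Induction on s1: its head occurs in s2 after some prefix s3, and moving it to the front costs
    the sign (-1)^(size s3). *)
Lemma wedge_cols_perm B s1 s2 Z : perm_eq s1 s2 ->
  exists e : nat, wedge_cols B s1 Z = (-1) ^+ e *: wedge_cols B s2 Z.
Proof.
elim: s1 s2 => [|i s1 IHs] s2.
  by rewrite perm_sym => /perm_nilP ->; exists 0%N; rewrite expr0 scale1r.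
move=> ps; have: i \in s2 by rewrite -(perm_mem ps) mem_head.
move=> is2; case/splitPr: is2 ps => s3 s4.
rewrite perm_sym -cat1s perm_catCA /= perm_cons perm_sym => /IHs[e E].
exists (e + size s3)%N; rewrite E !wedge_cols_cat /= wedge_cols_vec wedgeZr scalerA.
by rewrite exprD -mulrA -expr2 sqrr_sign mulr1.
Qed.

Lemma wedge_vec_cols_mem B s i Z : i \in s ->
  wedge (mv_of_vec (col i B)) (wedge_cols B s Z) = 0.
Proof.
case/splitPr => s1 s2; rewrite wedge_cols_cat /= wedge_cols_vec wedgeZr.
by rewrite wedgeA vec_wedge_vec wedge0l scaler0.
Qed.

Lemma wedge_cols_uniq B s Z : wedge_cols B s Z != 0 -> uniq s.
Proof.
elim: s => //= i s IHs nz; apply/andP; split.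
  by apply: contraNN nz => /wedge_vec_cols_mem ->.
by apply: IHs; apply: contraNneq nz => ->; rewrite wedge0r.
Qed.

Lemma homogeneous_wedge_cols B s q Z :
  homogeneous q Z -> homogeneous (size s + q) (wedge_cols B s Z).
Proof.
move=> hZ; elim: s => //= i s IHs.
by rewrite addSn -add1n; apply: homogeneous_wedge IHs; apply: homogeneous_mv_of_vec.
Qed.

Lemma wedge_cols_int B s Z : (forall i j, B i j \is a Num.int) ->
  (forall S, Z S \is a Num.int) -> forall S, wedge_cols B s Z S \is a Num.int.
Proof.
move=> BI ZI; elim: s => //= i s IHs; apply: wedge_int => //.
by apply: mv_of_vec_int => j; rewrite mxE.
Qed.

(** If Z has a nonzero coordinate at S, then |S| = q < d leaves an index i outside S, and e_i /\ Z
    has coordinate Z S, up to sign, at i |: S. *)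
Lemma vec_wedge_neq0 q Z : homogeneous q Z -> Z != 0 -> (q < d)%N ->
  exists v, wedge (mv_of_vec v) Z != 0.
Proof.
move=> hZ Z0 qd; have [S ZS] : exists S, Z S != 0.
  apply/existsP; apply: contraNT Z0; rewrite negb_exists => /forallP ZN.
  by apply/eqP/ffunP => S; rewrite ffunE; apply/eqP; rewrite -[_ == _]negbK.
have [i iS] : exists i, i \notin S.
  apply/existsP; apply: contraTT qd; rewrite negb_exists => /forallP SN.
  rewrite -leqNgt; have <- : #|S| = q by apply/eqP; apply: contraNT ZS => /hZ ->.
  by rewrite -[X in (X <= _)%N](card_ord d) subset_leq_card //; apply/fintype.subsetP => i _;
     rewrite -[_ \in _]negbK.
exists (delta_mx i 0); apply: contraNneq ZS => /ffunP/(_ (i |: S)%SET).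
have vE A : mv_of_vec (delta_mx i 0 : 'cV[R]_d) A = (A == [set i]%SET)%:R.
  rewrite ffunE; have [->|Ai] := eqVneq A [set i]%SET.
    rewrite (bigD1 i) //= big1 ?addr0 ?mxE ?eqxx // => j /andP[/eqP/set1_inj ->].
    by rewrite eqxx.
  rewrite big1 // => j /eqP Aj; rewrite mxE andbT.
  by case: eqP => // ji; rewrite Aj ji eqxx in Ai.
rewrite wedgeE (bigD1 [set i]%SET) ?finset.sub1set ?finset.setU11 //= big1 ?addr0; last first.
  by move=> A /andP[_ /negPf Ai]; rewrite vE Ai mulr0 mul0r.
have -> : ((i |: S) :\: [set i] = S)%SET.
  by rewrite setU1K.
rewrite vE eqxx mulr1 [RHS]ffunE => /eqP.
by rewrite mulf_eq0 signr_eq0.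
Qed.

(** The columns of B span the space; if all of them annihilated Z, so would every vector. *)
Lemma col_wedge_neq0 B q Z : B \in unitmx -> homogeneous q Z -> Z != 0 ->
  (q < d)%N -> exists j, wedge (mv_of_vec (col j B)) Z != 0.
Proof.
move=> uB hZ Z0 qd; have [v vZ] := vec_wedge_neq0 hZ Z0 qd.
apply/existsP; apply: contraNT vZ; rewrite negb_exists => /forallP BN.
rewrite -(mulKVmx uB v) mv_of_vec_mulmx wedge_suml big1 // => j _.
by move/negPn/eqP: (BN j); rewrite wedgeZl => ->; rewrite scaler0.
Qed.

Lemma wedge_cols_neq0_exists B q Z k : B \in unitmx -> homogeneous q Z -> Z != 0 ->
  (k + q <= d)%N -> exists2 s, size s = k & wedge_cols B s Z != 0.
Proof.
move=> uB hZ Z0; elim: k => [|k IHk] kd; first by exists [::].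
have [s sk sZ] := IHk (ltnW kd).
have [|j jZ] := col_wedge_neq0 uB (homogeneous_wedge_cols B (s := s) hZ) sZ.
  by rewrite sk.
by exists (j :: s) => //=; rewrite sk.
Qed.

(** Starting from 1, some d columns have a nonzero wedge. Their indices are distinct, hence they are
    all the indices, and up to sign this wedge contains the wedge over s as a factor. *)
Lemma wedge_cols_mv1_neq0 B s : B \in unitmx -> uniq s ->
  wedge_cols B s (mv1 R d) != 0.
Proof.
move=> uB us; have nz1 : mv1 R d != 0.
  apply/eqP => /ffunP/(_ finset.set0)/eqP; rewrite !ffunE eqxx.
  by rewrite oner_eq0.
have [|s0 s0d s0Z] := wedge_cols_neq0_exists (k := d) uB (@homogeneous_mv1 R d) nz1.
  by rewrite addn0.
have us0 := wedge_cols_uniq s0Z.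
have [|e E] := @wedge_cols_perm B s0 ([seq i <- s0 | i \notin s] ++ s) (mv1 R d).
  apply: uniq_perm => // [|i].
    rewrite cat_uniq filter_uniq // us andbT; apply/hasPn => i si.
    by rewrite mem_filter si.
  have s0T : i \in s0.
    have [||_ ->] := uniq_min_size us0 (s2 := enum 'I_d); last by rewrite mem_enum.
      by move=> j _; rewrite mem_enum.
    by rewrite size_enum_ord s0d.
  by rewrite mem_cat mem_filter s0T andbT orNb.
by apply: contraNneq s0Z => sZ; rewrite E wedge_cols_cat sZ wedge_cols0 scaler0.
Qed.

End WedgeCols.

(** * The sup-norm of column vectors *)

Section ColumnNorm.
Variable R : realType.

Definition colnorm d (v : 'cV[R]_d) : R := \big[Num.max/0]_i `|v i 0|.

Lemma colnorm_ge d (v : 'cV[R]_d) i : `|v i 0| <= colnorm v.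
Proof. exact: (le_bigmax _ (fun i => `|v i 0|)). Qed.

Lemma colnorm_le d (v : 'cV[R]_d) c :
  0 <= c -> (forall i, `|v i 0| <= c) -> colnorm v <= c.
Proof. by move=> c0 vc; apply: bigmax_le. Qed.

Lemma colnorm_ge0 d (v : 'cV[R]_d) : 0 <= colnorm v.
Proof. exact: bigmax_ge_id. Qed.

Lemma colnorm_argmax d (v : 'cV[R]_d.+1) : exists i, colnorm v = `|v i 0|.
Proof.
rewrite /colnorm (bigmax_eq_arg _ ord0) => [|//|i _]; last exact: normr_ge0.
by eexists.
Qed.

Lemma colnormZ_ge d (a : R) (v : 'cV[R]_d) : 1 <= `|a| -> colnorm v <= colnorm (a *: v).
Proof.
move=> a1; apply: colnorm_le => [|i]; first exact: colnorm_ge0.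
apply: le_trans (colnorm_ge _ i); rewrite mxE normrM.
by rewrite ler_peMl.
Qed.

Lemma colnorm_row_perm d (s : 'S_d) (v : 'cV[R]_d) : colnorm (row_perm s v) = colnorm v.
Proof.
apply/eqP; rewrite eq_le; apply/andP; split; apply: colnorm_le => [|i]; rewrite ?colnorm_ge0 //.
  by rewrite mxE colnorm_ge.
by have := colnorm_ge (row_perm s v) (s^-1 i)%g; rewrite mxE permKV.
Qed.

Lemma colnorm_mulmx_le d (A : 'M[R]_d) (v : 'cV[R]_d) :
  colnorm (A *m v) <= (\sum_i \sum_j `|A i j|) * colnorm v.
Proof.
apply: colnorm_le => [|i].
  by rewrite mulr_ge0 ?colnorm_ge0 // sumr_ge0 // => i _; rewrite sumr_ge0.
rewrite mxE (le_trans (ler_norm_sum _ _ _)) //.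
apply: (@le_trans _ _ ((\sum_j `|A i j|) * colnorm v)).
  rewrite mulr_suml ler_sum // => j _.
  by rewrite normrM ler_wpM2l // colnorm_ge.
rewrite ler_wpM2r ?colnorm_ge0 // [leRHS](bigD1 i) //= lerDl sumr_ge0 // => j _.
by rewrite sumr_ge0.
Qed.

End ColumnNorm.

(** * Hermite reduction of a lattice basis *)

Section HermiteReduction.
Variable R : realType.

Notation intmx := (map_mx (intr : int -> R)).

Lemma col_mulmx (K : pzRingType) m n p j (A : 'M[K]_(m, n)) (B : 'M[K]_(n, p)) :
  col j (A *m B) = A *m col j B.
Proof. by rewrite !colE mulmxA. Qed.

Lemma col_unitmx_neq0 (K : comUnitRingType) d (B : 'M[K]_d) j :
  B \in unitmx -> col j B != 0.
Proof.
move=> uB; apply/eqP => /(congr1 (mulmx (invmx B))).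
rewrite -!col_mulmx mulVmx // mulmx0 => /matrixP/(_ j 0).
by rewrite !mxE eqxx => /eqP; rewrite oner_eq0.
Qed.

Lemma norm_det_int_unit d (B : 'M[int]_d) : B \in unitmx -> `|\det (intmx B)| = 1.
Proof.
move=> uB; rewrite det_map_mx; move: uB; rewrite unitmxE => /orP[]/eqP->.
  by rewrite normr1.
by rewrite rmorphN1 normrN1.
Qed.

Lemma intmx_unit d (B : 'M[int]_d) : B \in unitmx -> intmx B \in unitmx.
Proof. by rewrite !unitmxE det_map_mx; apply: rmorph_unit. Qed.

(** Invertibility of G bounds the norms of nonzero lattice vectors away from 0, so their infimum is
    positive and some vector comes within the factor 3/2 of it. Settling for a factor avoids proving
    that the minimum is attained. *)
Lemma colnorm_near_min d (G : 'M[R]_d.+1) : G \in unitmx ->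
  exists2 z : 'cV[int]_d.+1, z != 0 & forall y : 'cV[int]_d.+1, y != 0 ->
    colnorm (G *m intmx z) <= 3 / 2 * colnorm (G *m intmx y).
Proof.
move=> uG; pose K := \sum_i \sum_j `|invmx G i j|.
have K0 : 0 <= K by rewrite sumr_ge0 // => i _; rewrite sumr_ge0.
have lb (y : 'cV[int]_d.+1) : y != 0 -> (K + 1)^-1 <= colnorm (G *m intmx y).
  move=> y0; have [i yi] : exists i, y i 0 != 0.
    apply/existsP; apply: contraNT y0; rewrite negb_exists => /forallP yN.
    apply/eqP/colP => i; rewrite mxE; apply/eqP.
    by rewrite -[_ == _]negbK.
  rewrite -[leLHS]mulr1 mulrC ler_pdivrMr ?ltr_wpDl //.
  apply: (@le_trans _ _ (colnorm (intmx y))).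
    apply: le_trans (colnorm_ge _ i); rewrite mxE.
    by rewrite norm_intr_ge1 ?intr_int ?intr_eq0.
  rewrite -{1}(mulKmx uG (intmx y)) (le_trans (colnorm_mulmx_le _ _)) //.
  by rewrite mulrC ler_wpM2l ?colnorm_ge0 // lerDl.
pose S := [set colnorm (G *m intmx y) | y in [set y : 'cV[int]_d.+1 | y != 0]]%classic.
have S0 : (S !=set0)%classic.
  exists (colnorm (G *m intmx (const_mx 1))), (const_mx 1) => //=.
  by apply/eqP => /colP/(_ 0); rewrite !mxE.
have Slb : lbound S (K + 1)^-1 by move=> _ [y /= y0 <-]; apply: lb.
have hS : has_inf S by split=> //; exists (K + 1)^-1.
have I0 : 0 < inf S by apply: lt_le_trans (lb_le_inf S0 Slb); rewrite invr_gt0 ltr_wpDl.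
have [|_ [z /= z0 <-] zI] := @inf_adherent _ S (inf S / 2) _ hS; first by rewrite divr_gt0.
exists z => // y y0.
have : inf S <= colnorm (G *m intmx y) by apply: ge_inf; [case: hS | exists y].
lra.
Qed.

(** The Smith form of a single column has at most one nonzero entry, at the top. Equivalently, a
    primitive vector extends to a basis of the lattice. *)
Lemma int_col_multiple_unit d (z : 'cV[int]_d.+1) :
  exists2 L : 'M[int]_d.+1, L \in unitmx & exists c, z = c *: col 0 L.
Proof.
have [L uL [P uP [e _ ->]]] := int_Smith_normal_form z.
exists L => //; exists (e`_0 * P 0 0).
apply/colP => i; rewrite !mxE big_ord1 !mxE (bigD1 0) //= big1 ?addr0.
  by rewrite !mxE eqxx mulr1n; ring.
by move=> j j0; rewrite !mxE -val_eqE /= in j0 *; rewrite (negPf j0) mulr0n mulr0.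
Qed.

Lemma round_half (x : R) : exists k : int, `|x + k%:~R| <= 1 / 2.
Proof.
exists (- Num.floor (x + 1 / 2)); rewrite rmorphN /=.
have := floor_le (x + 1 / 2); have := floorD1_gt (x + 1 / 2).
rewrite intrD /= ler_norml => h1 h2; apply/andP; split; lra.
Qed.

(* Make an almost shortest vector the first column, put its largest entry a at
   the top left, reduce the Schur complement H of a, and lift the columns of H so
   that their top entries are at most |a| / 2. The constant 3/2 < 2 of
   [colnorm_near_min] then bounds each lifted column by 4 times that of H. *)
Lemma hermite_step d (C : R) : 0 < C ->
  (forall G : 'M[R]_d, G \in unitmx -> exists2 B : 'M[int]_d, B \in unitmx &
    \prod_j colnorm (col j (G *m intmx B)) <= C * `|\det G|) ->
  forall G : 'M[R]_d.+1, G \in unitmx -> exists2 B : 'M[int]_d.+1, B \in unitmx &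
    \prod_j colnorm (col j (G *m intmx B)) <= 4 ^+ d * C * `|\det G|.
Proof.
move=> C0 IH G uG.
have [z z0 zmin] := colnorm_near_min uG.
have [L uL [k zL]] := int_col_multiple_unit z.
have k0 : k != 0 by apply: contraNneq z0 => k0; rewrite zL k0 scale0r.
(* Since z is a nonzero integer multiple of the first column of [L], that column is no longer than z
   and inherits its near-minimality. *)
have Lmin (y : 'cV[int]_d.+1) : y != 0 ->
    colnorm (col 0 (G *m intmx L)) <= 3 / 2 * colnorm (G *m intmx y).
  move=> /zmin; apply: le_trans; rewrite zL map_mxZ -scalemxAr map_col -col_mulmx.
  apply: colnormZ_ge.
  by rewrite norm_intr_ge1 ?intr_int ?intr_eq0.
have [i0 i0E] := colnorm_argmax (col 0 (G *m intmx L)).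
(* Swapping rows changes neither the column norms nor the absolute value of the determinant. *)
have [G' G'def] : exists G' : 'M[R]_(1 + d), G' = row_perm (tperm 0 i0) (G *m intmx L).
  by eexists.
have detG' : `|\det G'| = `|\det G|.
  rewrite G'def row_permE !det_mulmx !normrM norm_det_int_unit // mulr1.
  by rewrite det_perm normrX normrN1 expr1n mul1r.
pose a := G' 0 0; pose r := ursubmx G'; pose c := dlsubmx G'; pose S := drsubmx G'.
have G'0 i : `|G' i 0| <= `|a|.
  rewrite /a G'def !mxE tpermL; have := colnorm_ge (col 0 (G *m intmx L)) (tperm 0 i0 i).
  by rewrite i0E !mxE.
have aE : `|a| = colnorm (col 0 (G *m intmx L)) by rewrite i0E /a G'def !mxE tpermL.
have G'E : G' = block_mx a%:M r c S.
  by rewrite -[LHS]submxK; congr block_mx; rewrite [LHS]mx11_scalar !mxE;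
     congr (_%:M); congr (G' _ _); apply/val_inj.
have cE i : `|c i 0| <= `|a|.
  have := G'0 (rshift 1 i); rewrite !mxE.
  by rewrite (_ : lshift d 0 = 0) //; apply/val_inj.
pose H := S - a^-1 *: (c *m r).
have uG' : \det G' != 0 by rewrite -normr_eq0 detG' normr_eq0 -unitfE -unitmxE.
have a0 : a != 0.
  apply: contraNneq uG' => a0.
  have c0 i : G' i 0 = 0.
    by apply/eqP; rewrite -normr_eq0 eq_le normr_ge0 andbT (le_trans (G'0 i)) // a0 normr0.
  rewrite (expand_det_col _ 0) big1 // => i _; by rewrite c0 mul0r.
have detH : \det G' = a * \det H.
  have -> : G' = block_mx 1%:M 0 (a^-1 *: c) 1%:M *m block_mx a%:M r 0 H.
    rewrite mulmx_block !mul1mx !mul0mx !addr0 G'E /H.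
    rewrite mul_mx_scalar scalerA divff // scale1r -scalemxAl.
    by rewrite [_ *: _ + _]addrC subrK.
  by rewrite det_mulmx det_lblock det_ublock !det1 !mul1r det_scalar1.
have uH : H \in unitmx.
  by rewrite unitmxE unitfE; apply: contraNneq uG' => H0; rewrite detH H0 mulr0.
have [B uB Bprod] := IH H uH.
have [x xP] : exists x : 'rV[int]_d, forall j,
    `|a * (x 0 j)%:~R + (r *m intmx B) 0 j| <= `|a| / 2.
  have : forall j, exists k : int, `|a * k%:~R + (r *m intmx B) 0 j| <= `|a| / 2.
    move=> j; have [l lP] := round_half ((r *m intmx B) 0 j / a).
    exists l; rewrite addrC -[X in `|X + _|](mulfVK a0) [a * _]mulrC -mulrDl normrM.
    by rewrite mulrC ler_wpM2l // (le_trans lP) // mul1r.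
  by move=> /choice[f fP]; exists (\row_j f j) => j; rewrite !mxE in fP *; have := fP j; rewrite !mxE.
pose B1 : 'M[int]_(1 + d) := block_mx 1%:M x 0 B.
have uB1 : B1 \in unitmx.
  by rewrite unitmxE det_ublock det1 mul1r -unitmxE.
have uLB : L *m B1 \in unitmx by rewrite unitmx_mul uL.
exists (L *m B1) => //.
have prodE j : colnorm (col j (G *m intmx (L *m B1))) = colnorm (col j (G' *m intmx B1)).
  have -> : G' *m intmx B1 = row_perm (tperm 0 i0) (G *m intmx L *m intmx B1).
    by rewrite G'def !row_permE -!mulmxA.
  rewrite map_mxM mulmxA -(colnorm_row_perm (tperm 0 i0) (col j (_ *m intmx B1))).
  by congr colnorm; apply/colP => i; rewrite mxE [col _ _ _ _]mxE [RHS]mxE [RHS]mxE.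
have lastE : G' *m intmx B1 = block_mx a%:M (a *: intmx x + r *m intmx B)
                               c (c *m intmx x + S *m intmx B).
  by rewrite G'E map_block_mx mulmx_block map_mx1 map_mx0 !mulmx1 !mulmx0 !addr0 mul_scalar_mx.
have colE j : colnorm (col (rshift 1 j) (G' *m intmx B1)) <=
    4 * colnorm (col j (H *m intmx B)).
  have lbd : `|a| <= 3 / 2 * colnorm (col (rshift 1 j) (G' *m intmx B1)).
    rewrite aE -prodE [col (rshift _ _) _]col_mulmx -map_col; apply: Lmin.
    exact: col_unitmx_neq0.
  (* Writing X for the lifted column norm and h for that of H, the bounds X <= h + |a| / 2 and |a|
     <= 3/2 X give X <= h + 3/4 X, that is X <= 4 h. *)
  suff : colnorm (col (rshift 1 j) (G' *m intmx B1)) <=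
      colnorm (col j (H *m intmx B)) + `|a| / 2 by lra.
  have up : `|(a *: intmx x + r *m intmx B) 0 j| <= `|a| / 2.
    by have := xP j; rewrite !mxE.
  apply: colnorm_le => [|i]; first by rewrite addr_ge0 ?colnorm_ge0 ?divr_ge0.
  rewrite lastE mxE; case: (split_ordP i) => i' ->.
    rewrite block_mxEur (ord1 i') (le_trans up) // lerDr colnorm_ge0 //.
  rewrite block_mxEdr.
  (* The lower block differs from H B by c / a times the reduced top row; as |c_i| <= |a|, this
     error is at most |a| / 2. *)
  have -> : c *m intmx x + S *m intmx B =
     H *m intmx B + a^-1 *: (c *m (a *: intmx x + r *m intmx B)).
    rewrite /H mulmxBl mulmxDr -!scalemxAr scalerDr scalerA mulVf // scale1r.
    by rewrite -scalemxAl mulmxA addrCA subrK addrC.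
  rewrite mxE (le_trans (ler_normD _ _)) // lerD //.
    by have := colnorm_ge (col j (H *m intmx B)) i'; rewrite !mxE.
  rewrite mxE [(c *m _) _ _]mxE big_ord1 mulrA normrM (le_trans _ up) // ler_piMl //.
  rewrite normrM normfV mulrC ler_pdivrMr ?normr_gt0 // mul1r.
  exact: cE.
rewrite (eq_bigr _ (fun j _ => prodE j)) -detG' detH normrM.
rewrite (@big_split_ord _ _ _ 1 d) /= big_ord1.
have -> : 4 ^+ d * C * (`|a| * `|\det H|) = `|a| * (4 ^+ d * (C * `|\det H|)) by ring.
apply: ler_pM; rewrite ?colnorm_ge0 ?prodr_ge0 //.
- by move=> j _; apply: colnorm_ge0.
- apply: colnorm_le => // i; rewrite lastE mxE; case: (split_ordP i) => i' ->.
    by rewrite block_mxEul !ord1 mxE eqxx mulr1n.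
  rewrite block_mxEdl.
  exact: cE.
- rewrite (le_trans (y := \prod_j (4 * colnorm (col j (H *m intmx B))))) //.
    by apply: ler_prod => j _; rewrite colnorm_ge0 colE.
  by rewrite big_split prodr_const card_ord /= ler_wpM2l ?exprn_ge0.
Qed.

(** The induction yields C = 4^(d(d-1)/2). That C depends on d alone is essential, because G will
    vary with T. *)
Theorem hermite_reduction d : exists2 C : R, 0 < C &
  forall G : 'M[R]_d, G \in unitmx -> exists2 B : 'M[int]_d, B \in unitmx &
    \prod_j colnorm (col j (G *m intmx B)) <= C * `|\det G|.
Proof.
elim: d => [|d [C C0 IH]].
  exists 1 => // G _; exists 1%:M; first exact: unitmx1.
  by rewrite big_ord0 det_mx00 normr1 mulr1.
exists (4 ^+ d * C); first by rewrite mulr_gt0 ?exprn_gt0.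
exact: hermite_step.
Qed.

End HermiteReduction.

(** * The weight W and its growth under wedging *)

Section Weight.
Variables (R : realType) (m n : nat) (Theta : 'M[R]_(n, m)).
Local Notation d := (m + n)%N.
Local Notation ell := (ell_mx Theta).
Local Notation intmx := (map_mx (intr : int -> R)).
Implicit Types (Z : multivector R d) (v : 'cV[R]_d) (T : R) (sigma : {set 'I_d}).

(* ell_mx is the identity plus an antisymmetric matrix, so v ell v^T = |v|^2. *)
Lemma ell_mx_unit : ell \in unitmx.
Proof.
rewrite -row_free_unit; apply: inj_row_free => v vE.
have tE : ell + ell^T = 2%:M.
  rewrite /ell_mx tr_block_mx !trmx1 raddfN /= trmxK add_block_mx addNr subrr.
  by rewrite -!raddfD /= -scalar_mx_block.
have : v *m (ell + ell^T) *m v^T = 0.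
  rewrite mulmxDr mulmxDl vE mul0mx add0r -mulmxA -trmx_mul.
  by rewrite vE trmx0 mulmx0.
rewrite tE mul_mx_scalar -scalemxAl => /matrixP/(_ 0 0).
rewrite mxE [RHS]mxE mxE => /eqP; rewrite mulf_eq0 pnatr_eq0 /=.
rewrite psumr_eq0 => [/allP v0|i _]; last by rewrite mxE -expr2 sqr_ge0.
apply/rowP => i; rewrite [RHS]mxE; apply/eqP.
by have := v0 i (mem_index_enum _); rewrite mxE -expr2 sqrf_eq0.
Qed.

Lemma Lvec_wedge sigma Z : wedge (Lvec Theta sigma) Z = wedge_cols ell (enum sigma) Z.
Proof. exact: wedge_bigE. Qed.

Definition low sigma := [forall i in sigma, (i < m)%N].

Lemma card_low sigma : low sigma -> (#|sigma| <= m)%N.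
Proof.
move=> /forall_inP sm; rewrite -[X in (_ <= X)%N](card_ord m).
rewrite -(card_imset _ (@lshift_inj m n)) subset_leq_card //.
apply/fintype.subsetP => i /sm im; apply/imsetP; exists (Ordinal im) => //.
exact/val_inj.
Qed.

Definition weight T Z : R :=
  \big[Num.max/0]_(sigma | low sigma) (T ^+ #|sigma| * supnorm (wedge (Lvec Theta sigma) Z)).

Lemma weight_ge T Z sigma : low sigma ->
  T ^+ #|sigma| * supnorm (wedge (Lvec Theta sigma) Z) <= weight T Z.
Proof. by move=> ls; rewrite /weight (bigmaxD1 sigma) // le_max lexx. Qed.

Lemma weight_le T Z c : 0 <= c -> (forall sigma, low sigma ->
  T ^+ #|sigma| * supnorm (wedge (Lvec Theta sigma) Z) <= c) -> weight T Z <= c.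
Proof. by move=> c0 Zc; apply: bigmax_le. Qed.

Lemma weight_ge0 T Z : 0 <= weight T Z.
Proof. exact: bigmax_ge_id. Qed.

(** This is the term of the empty sigma. *)
Lemma supnorm_le_weight T Z : supnorm Z <= weight T Z.
Proof.
have l0 : low finset.set0 by apply/forall_inP => i; rewrite inE.
apply: le_trans (weight_ge T Z l0).
by rewrite cards0 expr0 mul1r Lvec_wedge enum_set0.
Qed.

(** A set sigma in the maximum has at most m elements, so T^|sigma| <= T^m for T >= 1. The constant
    is uniform in T and Z. *)
Lemma weight_le_supnorm : exists2 K, 0 < K & forall T Z, 1 <= T ->
  weight T Z <= K * T ^+ m * supnorm Z.
Proof.
pose K := (2 ^ d)%:R * \sum_(sigma : {set 'I_d}) supnorm (Lvec Theta sigma).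
have S0 : 0 <= \sum_(sigma : {set 'I_d}) supnorm (Lvec Theta sigma).
  by apply: sumr_ge0 => s _; apply: supnorm_ge0.
have K0 : 0 <= K by rewrite mulr_ge0.
exists (K + 1) => [|T Z T1]; first by rewrite ltr_wpDl.
have T0 : 0 <= T by rewrite (le_trans _ T1).
apply: weight_le => [|s ls]; first by rewrite !mulr_ge0 ?exprn_ge0 ?supnorm_ge0 ?addr_ge0.
rewrite [_ * T ^+ m]mulrC -mulrA ler_pM ?exprn_ge0 ?supnorm_ge0 //.
  by rewrite ler_weXn2l // card_low.
rewrite (le_trans (supnorm_wedge_le _ _)) // ler_wpM2r ?supnorm_ge0 //.
rewrite (@le_trans _ _ K) ?lerDl // ler_wpM2l // (bigD1 s) //= lerDl.
by apply: sumr_ge0 => s' _; apply: supnorm_ge0.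
Qed.

(** The norm N(v) is [colnorm (ell_scale T *m v)]: coordinates in the basis of the ell_j, the first
    m of them divided by T. *)
Definition ell_scale T : 'M[R]_d :=
  diag_mx (\row_j (if (j < m)%N then T^-1 else 1)) *m invmx ell.

Lemma ell_scaleE T v j :
  (ell_scale T *m v) j 0 = (if (j < m)%N then T^-1 else 1) * (invmx ell *m v) j 0.
Proof. by rewrite -mulmxA mul_diag_mx !mxE. Qed.

Lemma det_ell_scale T : \det (ell_scale T) = T ^- m / \det ell.
Proof.
rewrite det_mulmx det_inv det_diag big_split_ord /= -[RHS]mulr1 mulrAC; congr (_ * _).
rewrite (eq_bigr (fun=> T^-1)) => [|i _]; last by rewrite mxE /= ltn_ord.
rewrite prodr_const card_ord exprVn; congr (_ * _).
by rewrite big1 // => i _; rewrite mxE /= ltnNge leq_addr.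
Qed.

Lemma ell_scale_unit T : 0 < T -> ell_scale T \in unitmx.
Proof.
move=> T0; rewrite unitmxE unitfE det_ell_scale mulf_neq0 ?invr_eq0 ?expf_neq0 ?(lt0r_neq0 T0) //.
by rewrite -unitfE -unitmxE ell_mx_unit.
Qed.

(** Expand v as the sum of the c_j ell_j. For j <= m, |c_j| <= T N(v), and ell_j either kills
    L_sigma or enlarges sigma by j, where the weight carries the extra factor T. For j > m, |c_j| <=
    N(v), and wedging with ell_j costs only a constant. *)
Lemma weight_vec_wedge : exists2 K, 0 < K & forall T v Z, 1 <= T ->
  weight T (wedge (mv_of_vec v) Z) <= K * weight T Z * colnorm (ell_scale T *m v).
Proof.
pose L := \sum_j supnorm (mv_of_vec (col j ell)).
have L0 : 0 <= L by apply: sumr_ge0 => j _; apply: supnorm_ge0.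
pose K := 1 + (2 ^ d)%:R * L.
have K0 : 1 <= K by rewrite lerDl mulr_ge0.
have K0' : 0 <= K by apply: le_trans K0.
exists (d%:R * K + 1) => [|T v Z T1]; first by rewrite ltr_wpDl // mulr_ge0.
have T0 : 0 < T by rewrite (lt_le_trans _ T1).
set W := weight T Z; set N := colnorm _.
have W0 : 0 <= W := weight_ge0 T Z.
have N0 : 0 <= N := colnorm_ge0 _.
apply: weight_le => [|s ls]; first by rewrite !mulr_ge0 ?addr_ge0 ?mulr_ge0.
apply: (@le_trans _ _ (d%:R * (K * W * N))); last first.
  have := mulr_ge0 W0 N0; nra.
pose c := invmx ell *m v.
rewrite -(mulKVmx ell_mx_unit v) -/c mv_of_vec_mulmx wedge_suml wedge_sumr.
apply: (@le_trans _ _ (T ^+ #|s| * \sum_j `|c j 0| *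
   supnorm (wedge (Lvec Theta s) (wedge (mv_of_vec (col j ell)) Z)))).
  rewrite ler_wpM2l ?exprn_ge0 ?(ltW T0) // (le_trans (supnorm_sum_le _ _ _)) //.
  by apply: ler_sum => j _; rewrite wedgeZl wedgeZr supnormZ_le.
rewrite mulr_sumr; apply: (@le_trans _ _ (\sum_(j < d) K * W * N)); last first.
  by rewrite sumr_const card_ord mulr_natl.
apply: ler_sum => j _; have := colnorm_ge (ell_scale T *m v) j.
rewrite ell_scaleE -/c -/N Lvec_wedge; case: ifP => jm.
  rewrite normrM normfV (gtr0_norm T0) mulrC ler_pdivrMr // => cN.
  have [js|js] := boolP (j \in s).
    rewrite wedge_cols_vec wedge_vec_cols_mem ?mem_enum // scaler0 supnorm0.
    by rewrite !mulr0 !mulr_ge0.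
  (* Up to sign, L_sigma /\ ell_j is L_(sigma + j), whose factors are in increasing order. *)
  have [|e E] := @wedge_cols_perm _ _ ell (rcons (enum s) j) (enum (j |: s)%SET) Z.
    apply: uniq_perm => [||i]; rewrite ?enum_uniq //.
      by rewrite rcons_uniq mem_enum js enum_uniq.
    by rewrite mem_rcons inE !mem_enum !inE.
  have ljs : low (j |: s).
    apply/forall_inP => i; rewrite !inE => /orP[/eqP -> //|].
    by move/forall_inP: ls; apply.
  rewrite -cats1 wedge_cols_cat /= in E; rewrite E.
  rewrite -signr_odd supnorm_sign -Lvec_wedge.
  have := weight_ge T Z ljs; rewrite cardsU1 js add1n exprS -/W => h.
  have h0 : 0 <= T ^+ #|s| * supnorm (wedge (Lvec Theta (j |: s)) Z).
    by rewrite mulr_ge0 ?exprn_ge0 ?supnorm_ge0 ?(ltW T0).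
  rewrite mulrCA; apply: le_trans (ler_wpM2r h0 cN) _.
  move: h; set X := supnorm _; set t := T ^+ _ => h.
  have -> : N * T * (t * X) = T * t * X * N by ring.
  by apply: ler_wpM2r => //; apply: le_trans h _; rewrite ler_peMl.
rewrite mul1r => cN; rewrite wedge_cols_vec -signr_odd supnorm_sign.
apply: (@le_trans _ _ (T ^+ #|s| * (N * ((2 ^ d)%:R * L * supnorm (wedge_cols ell (enum s) Z))))).
  rewrite ler_wpM2l ?exprn_ge0 ?(ltW T0) // ler_pM ?supnorm_ge0 //.
  rewrite (le_trans (supnorm_wedge_le _ _)) // ler_wpM2r ?supnorm_ge0 // ler_wpM2l //.
  rewrite /L (bigD1 j) //= lerDl.
  by apply: sumr_ge0 => i _; apply: supnorm_ge0.
have := weight_ge T Z ls; rewrite -/W Lvec_wedge => h.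
have -> : T ^+ #|s| * (N * ((2 ^ d)%:R * L * supnorm (wedge_cols ell (enum s) Z))) =
  (2 ^ d)%:R * L * (T ^+ #|s| * supnorm (wedge_cols ell (enum s) Z)) * N by ring.
apply: ler_wpM2r => //; apply: ler_pM; rewrite ?mulr_ge0 ?exprn_ge0 ?supnorm_ge0 ?(ltW T0) //.
by rewrite lerDr.
Qed.

Lemma weight_wedge_cols : exists2 K, 0 < K & forall T B s Z, 1 <= T ->
  weight T (wedge_cols B s Z) <=
  K ^+ size s * weight T Z * \prod_(i <- s) colnorm (col i (ell_scale T *m B)).
Proof.
have [K K0 KP] := weight_vec_wedge; exists K => // T B s Z T1.
elim: s => [|i s IHs] /=; first by rewrite big_nil mulr1 mul1r.
rewrite big_cons exprS; apply: le_trans (KP _ _ _ T1) _.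
rewrite col_mulmx.
set N := colnorm _; set P := \prod_(_ <- _) _ in IHs *.
have -> : K * K ^+ size s * weight T Z * (N * P) = K * (K ^+ size s * weight T Z * P) * N.
  by ring.
by rewrite ler_wpM2r ?colnorm_ge0 // ler_wpM2l ?(ltW K0).
Qed.

End Weight.

(** * Passing from degree p to degree p + 1 *)

Section GoingUp.
Variables (R : realType) (m n : nat) (Theta : 'M[R]_(n, m)).
Local Notation d := (m + n)%N.
Local Notation intmx := (map_mx (intr : int -> R)).

Lemma expr_size_le_prod (I : eqType) (s : seq I) (N : I -> R) a : 0 <= a ->
  (forall i, i \in s -> a <= N i) -> a ^+ size s <= \prod_(i <- s) N i.
Proof.
move=> a0; elim: s => [|i s IHs] aN; first by rewrite big_nil.
rewrite big_cons exprS ler_pM ?exprn_ge0 ?aN ?mem_head // IHs // => j js.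
by rewrite aN // inE js orbT.
Qed.

Lemma seq_argmin (I : eqType) (s : seq I) (N : I -> R) : s != [::] ->
  exists2 i, i \in s & forall j, j \in s -> N i <= N j.
Proof.
elim: s => // i s IHs _; have [->|s0] := eqVneq s [::].
  by exists i; rewrite ?mem_head // => j; rewrite inE => /eqP ->.
have [k ks kmin] := IHs s0; have [ik|ki] := leP (N i) (N k).
  exists i; rewrite ?mem_head // => j; rewrite inE => /predU1P[->//|js].
  exact: le_trans ik (kmin _ js).
exists k; rewrite ?inE ?ks ?orbT // => j; rewrite inE => /predU1P[->|/kmin//].
exact: ltW.
Qed.

(** Here q + 1 = d - p vectors are wedged with Z, and q of them remain after the one of smallest N
    is dropped. *)
Theorem weight_going_up p q : (p + q.+1 = d)%N -> exists2 K, 0 < K &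
  forall T (Z : multivector R d), 1 <= T -> integral_multivector p Z -> Z != 0 ->
  exists Y : multivector R d, [/\ integral_multivector p.+1 Y, Y != 0 &
    weight Theta T Y ^+ q.+1 <= K * weight Theta T Z ^+ q].
Proof.
move=> pq.
have [C C0 CP] := hermite_reduction R d.
have [K K0 KP] := weight_wedge_cols Theta.
have [L L0 LP] := weight_le_supnorm Theta.
pose e := `|\det (ell_mx Theta)|^-1.
have e0 : 0 < e.
  by rewrite invr_gt0 normr_gt0 -unitfE -unitmxE ell_mx_unit.
have [[[K0' L0'] C0'] e0'] := (ltW K0, ltW L0, ltW C0, ltW e0).
have s10 : 0 <= supnorm (mv1 R d) := supnorm_ge0 _.
pose A := K ^+ p.+1 * (L * supnorm (mv1 R d)) * (C * e).
have A0 : 0 <= A by rewrite !mulr_ge0 ?exprn_ge0.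
(* Adding 1 makes the constant positive, since only A >= 0 is at hand. *)
exists (A ^+ q.+1 * (K ^+ q.+1) ^+ q + 1).
  by rewrite ltr_wpDl // mulr_ge0 ?exprn_ge0.
move=> T Z T1 [hZ ZI] Z0; have T0 : 0 < T by apply: lt_le_trans T1.
have uG := ell_scale_unit Theta T0.
have [B uB Bprod] := CP _ uG.
pose N i := colnorm (col i (ell_scale Theta T *m intmx B)).
have N0 i : 0 <= N i by apply: colnorm_ge0.
have prodN0 (s : seq 'I_d) : 0 <= \prod_(i <- s) N i by apply: prodr_ge0.
have uBR := intmx_unit R uB.
have BI i j : intmx B i j \is a Num.int by rewrite mxE intr_int.
have [|s sq sZ] := wedge_cols_neq0_exists (k := q.+1) uBR hZ Z0.
  by rewrite addnC pq.
have us := wedge_cols_uniq sZ.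
(* The wedge of Z with the columns in s is integral and nonzero, so its sup-norm, hence its weight,
   is at least 1. *)
have W1 : 1 <= K ^+ q.+1 * weight Theta T Z * \prod_(i <- s) N i.
  rewrite -{1}sq; apply: le_trans (KP _ _ _ _ T1).
  apply: le_trans (supnorm_le_weight Theta T _).
  by apply: supnorm_int_ge1 => //; apply: wedge_cols_int.
have [|i0 i0s i0min] := @seq_argmin _ s N; first by rewrite -size_eq0 sq.
pose s' := rem i0 s; have ps' : perm_eq s (i0 :: s') := perm_to_rem i0s.
have ss' : size s' = q by rewrite size_rem // sq.
have us' : uniq s' by apply: rem_uniq.
pose r := [seq i <- enum 'I_d | i \notin s'].
have pr : perm_eq (r ++ s') (enum 'I_d).
  apply: uniq_perm => [||i]; rewrite ?enum_uniq //.
    rewrite cat_uniq filter_uniq ?enum_uniq // us' andbT.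
    by apply/hasPn => i si; rewrite mem_filter si.
  by rewrite mem_cat mem_filter mem_enum andbT orNb.
have sr : size r = p.+1.
  apply: (@addIn q); rewrite addSnnS pq -ss'.
  by have := perm_size pr; rewrite size_cat size_enum_ord.
pose Y := wedge_cols (intmx B) r (mv1 R d).
exists Y; split.
- split; last by apply: wedge_cols_int => // S; apply: mv1_int.
  by rewrite -sr -[size r]addn0; apply: homogeneous_wedge_cols; apply: homogeneous_mv1.
- by apply: wedge_cols_mv1_neq0 => //; rewrite filter_uniq ?enum_uniq.
pose P := \prod_(i <- s') N i; have P0 : 0 <= P := prodN0 s'.
set W := weight Theta T Z in W1 *; have W0 : 0 <= W := weight_ge0 _ _ _.
have Y0 : 0 <= weight Theta T Y := weight_ge0 _ _ _.
have rP : \prod_(i <- r) N i * P = \prod_i N i.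
  transitivity (\prod_(i <- r ++ s') N i); first by rewrite big_cat.
  by rewrite (perm_big _ pr) big_enum.
(* The weight of 1 is at most a constant times T^m, and r and s' together exhaust the basis, so the
   product of all N is of order T^(-m). The powers of T cancel. *)
have YP : weight Theta T Y * P <= A.
  have : weight Theta T Y <= K ^+ p.+1 * (L * T ^+ m * supnorm (mv1 R d)) * \prod_(i <- r) N i.
    rewrite -sr; apply: le_trans (KP _ _ _ _ T1) _.
    by rewrite ler_wpM2r // ler_wpM2l ?exprn_ge0 // LP.
  move/(ler_wpM2r P0)/le_trans; apply; rewrite -(mulrA _ _ P) rP.
  apply: (@le_trans _ _ (K ^+ p.+1 * (L * T ^+ m * supnorm (mv1 R d)) * (C * (T ^- m * e)))).
    apply: ler_wpM2l; first by rewrite !mulr_ge0 ?exprn_ge0 ?(ltW T0).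
    apply: le_trans Bprod _.
    by rewrite det_ell_scale normrM normfV normrX (gtr0_norm T0) normfV.
  rewrite le_eqVlt; apply/orP; left; apply/eqP; rewrite /A.
  have Tm : T ^+ m != 0 by rewrite expf_neq0 // gt_eqF.
  by field.
(* The dropped factor N i0 is the smallest, so its q-th power is at most the product P of the q
   others. *)
have sP : (\prod_(i <- s) N i) ^+ q <= P ^+ q.+1.
  rewrite (perm_big _ ps') big_cons exprMn [P ^+ _]exprS ler_wpM2r ?exprn_ge0 //.
  rewrite -ss'; apply: expr_size_le_prod => // i /mem_rem; exact: i0min.
have W1' : 1 <= (K ^+ q.+1 * W) ^+ q * P ^+ q.+1.
  apply: (@le_trans _ _ ((K ^+ q.+1 * W * \prod_(i <- s) N i) ^+ q)).
    exact: exprn_ege1.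
  by rewrite exprMn ler_wpM2l // exprn_ge0 // mulr_ge0 ?exprn_ge0.
apply: (@le_trans _ _ (weight Theta T Y ^+ q.+1 * ((K ^+ q.+1 * W) ^+ q * P ^+ q.+1))).
  by rewrite ler_peMr // exprn_ge0.
apply: (@le_trans _ _ (A ^+ q.+1 * ((K ^+ q.+1) ^+ q * W ^+ q))).
  rewrite mulrCA -exprMn [leLHS]mulrC (exprMn q (K ^+ q.+1)).
  apply: ler_pM; rewrite ?exprn_ge0 ?mulr_ge0 ?exprn_ge0 //.
  by apply: lerXn2r; rewrite ?nnegrE ?A0 ?(mulr_ge0 Y0 P0).
by rewrite mulrA ler_wpM2r ?exprn_ge0 // lerDl.
Qed.

End GoingUp.

(** * From exponents to growth rates of the weight *)

Section Rates.
Variables (R : realType) (m n : nat) (Theta : 'M[R]_(n, m)).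
Local Notation d := (m + n)%N.

(* The substitution T = t^(1 + gamma), r = 1 / (1 + gamma) turns the system of
   the statement into a single inequality for [weight T Z]. *)
Definition rate_solvable p (r T : R) : Prop := exists Z : multivector R d,
  [/\ integral_multivector p Z, Z != 0 & weight Theta T Z <= T `^ (r + (m - p)%N%:R)].

Definition rate p r : Prop := \forall T \near +oo, rate_solvable p r T.

(** With t = T^r the k-th bound is T^(r - k + k_0); multiplied by T^k it becomes T^(r + k_0), the
    same for every k. *)
Lemma second_type_solvableE p r gamma T : 0 < T -> 0 < r -> 1 + gamma = r^-1 ->
  second_type_solvable Theta p gamma (T `^ r) <-> rate_solvable p r T.
Proof.
move=> T0 r0 gr.
have key k : (T `^ r) `^ (1 - (k%:R - (m - p)%N%:R) * (1 + gamma)) * T ^+ k =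
    T `^ (r + (m - p)%N%:R).
  rewrite -powRrM -powR_mulrn ?ltW // -powRD; last by rewrite (gt_eqF T0) implybT.
  by congr (_ `^ _); rewrite gr; field; rewrite gt_eqF.
split=> -[Z [Zp Z0 ZP]]; exists Z; split=> //.
  apply: weight_le => [|s ls]; first exact: powR_ge0.
  rewrite -(key #|s|) mulrC ler_wpM2r ?exprn_ge0 ?(ltW T0) //.
  apply: le_trans (ZP _ (card_low ls)).
  by rewrite (bigmaxD1 s) ?le_max ?lexx // inE eqxx.
move=> k km; apply: bigmax_le => [|s]; first exact: powR_ge0.
rewrite inE => /andP[/eqP sk ls].
rewrite -(ler_pM2r (exprn_gt0 k T0)) key mulrC -sk.
exact: le_trans (weight_ge Theta T Z ls) ZP.
Qed.

Lemma near_pinfty_powR (r : R) (P : R -> Prop) : 0 < r ->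
  (\forall T \near +oo, P T) -> \forall T \near +oo, P (T `^ r).
Proof.
move=> r0 [M [_ MP]]; exists ((Num.max 1 M) `^ r^-1); split; first exact: num_real.
move=> T MT; apply: MP.
have M1 : 0 < Num.max 1 M by rewrite lt_max ltr01.
have : (Num.max 1 M `^ r^-1) `^ r < T `^ r.
  by rewrite gt0_ltr_powR ?nnegrE ?powR_ge0 // (le_trans _ (ltW MT)) ?powR_ge0.
rewrite -powRrM mulVf ?gt_eqF // powRr1 ?ltW //.
by apply: le_lt_trans; rewrite le_max lexx orbT.
Qed.

Lemma near_solvable_rate p r gamma : 0 < r -> 1 + gamma = r^-1 ->
  (\forall t \near +oo, second_type_solvable Theta p gamma t) <-> rate p r.
Proof.
move=> r0 gr; split=> [H|H].
  have {H} := near_pinfty_powR r0 H; apply: filter_app.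
  near=> T => H; have T0 : 0 < T by near: T; apply: nbhs_pinfty_gt.
  exact/(second_type_solvableE _ T0 r0 gr).
have ri0 : 0 < r^-1 by rewrite invr_gt0.
have {H} := near_pinfty_powR ri0 H; apply: filter_app.
near=> t => H; have t0 : 0 < t by near: t; apply: nbhs_pinfty_gt.
have -> : t = (t `^ r^-1) `^ r by rewrite -powRrM mulVf ?gt_eqF // powRr1 // ltW.
exact/(second_type_solvableE _ (powR_gt0 _ t0) r0 gr).
Unshelve. all: by end_near.
Qed.

Lemma rateW p r r' : r <= r' -> rate p r -> rate p r'.
Proof.
move=> rr'; apply: filter_app; near=> T => -[Z [Zp Z0 ZP]]; exists Z; split=> //.
apply: le_trans ZP _; apply: ler_powR; last by rewrite lerD2r.
by near: T; apply: nbhs_pinfty_ge; apply: num_real.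
Unshelve. all: by end_near.
Qed.

Lemma near_powR_ge (K e : R) : 0 < e -> \forall T \near +oo, K <= T `^ e.
Proof.
move=> e0; apply: (near_pinfty_powR e0 (P := fun T => K <= T)).
by apply: nbhs_pinfty_ge; apply: num_real.
Qed.

(** A basis multivector has weight at most K T^m, which is below T^(m + 1) once T >= K. *)
Lemma rate_ex p : (p <= d)%N -> exists2 r, 0 < r & rate p r.
Proof.
move=> pd; exists (m%:R + 1); first by rewrite ltr_wpDl.
have [K K0 KP] := weight_le_supnorm Theta.
have [S Sp] : exists S : {set 'I_d}, #|S| = p.
  exists [set i in take p (enum 'I_d)]%SET; rewrite cardsE.
  by rewrite (card_uniqP (take_uniq _ (enum_uniq _))) size_takel ?size_enum_ord.
pose Z : multivector R d := [ffun A => (A == S)%:R].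
have Z1 : supnorm Z <= 1.
  by apply: supnorm_le => // A; rewrite ffunE; case: eqP; rewrite ?normr1 ?normr0.
near=> T; exists Z; split.
- split=> A; rewrite ffunE.
    by apply: contraNeq; rewrite pnatr_eq0 eqb0 negbK => /eqP ->; rewrite Sp.
  by case: eqP.
- apply/eqP => /ffunP/(_ S)/eqP; rewrite !ffunE eqxx.
  by rewrite oner_eq0.
have T1 : 1 <= T by near: T; apply: nbhs_pinfty_ge; apply: num_real.
have T0 : 0 < T by apply: lt_le_trans T1.
have KT : K <= T by near: T; apply: nbhs_pinfty_ge; apply: num_real.
apply: (le_trans (KP _ _ T1)); apply: (@le_trans _ _ (T `^ (m%:R + 1))); last first.
  by apply: ler_powR => //; rewrite lerDl.
rewrite powRD ?(gt_eqF T0) ?implybT // powR_mulrn ?powRr1 ?(ltW T0) //.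
rewrite -[leRHS]mulr1 ler_pM ?supnorm_ge0 ?mulr_ge0 ?exprn_ge0 ?(ltW K0) ?(ltW T0) //.
by rewrite mulrC ler_pM2l ?exprn_gt0.
Unshelve. all: by end_near.
Qed.

(** The strict inequality leaves a positive power of T to absorb the constant of
    [weight_going_up]. *)
Lemma rate_going_up p q r r' : (p + q.+1 = d)%N -> rate p r ->
  (r + (m - p)%N%:R) * q%:R < (r' + (m - p.+1)%N%:R) * q.+1%:R -> rate p.+1 r'.
Proof.
move=> pq + rr'; have [K K0 KP] := weight_going_up Theta pq.
move: rr'; set a := _ * q%:R; set b := _ * q.+1%:R => ab.
apply: filter_app; near=> T => -[Z [Zp Z0 ZP]].
have T1 : 1 <= T by near: T; apply: nbhs_pinfty_ge; apply: num_real.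
have T0 : 0 < T by apply: lt_le_trans T1.
have [Y [Yp Y0 YP]] := KP T Z T1 Zp Z0; exists Y; split=> //.
have KT : K <= T `^ (b - a) by near: T; apply: near_powR_ge; rewrite subr_gt0.
rewrite -(@ler_pXn2r _ q.+1) ?nnegrE ?weight_ge0 ?powR_ge0 //.
apply: (le_trans YP); apply: (@le_trans _ _ (T `^ (b - a) * T `^ a)).
  rewrite ler_pM ?exprn_ge0 ?weight_ge0 ?(ltW K0) // /a powRrM powR_mulrn ?powR_ge0 //.
  by rewrite lerXn2r ?nnegrE ?weight_ge0 ?powR_ge0.
rewrite -powRD ?subrK; last by rewrite (gt_eqF T0) implybT.
by rewrite /b powRrM powR_mulrn ?powR_ge0.
Unshelve. all: by end_near.
Qed.

(** Under 1 + gamma = 1 / r a larger gamma means a smaller r, so the supremum of the gamma turns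
    into the infimum rho of the positive rates, with 1 / 0 = +oo. *)
Lemma exp_a_rate p : (p <= d)%N -> exists rho : R,
  [/\ 0 <= rho, (1 + exp_a Theta p)%E = (rho%:E^-1)%E,
      forall r, 0 < r -> rate p r -> rho <= r & forall r, rho < r -> rate p r].
Proof.
move=> pd; pose S := [set r | 0 < r /\ rate p r]%classic.
have S0 : (S !=set0)%classic by have [r r0 rP] := rate_ex pd; exists r.
have Slb : lbound S 0 by move=> r [/ltW].
have hS : has_inf S by split=> //; exists 0.
set rho := inf S.
have rho0 : 0 <= rho by apply: lb_le_inf.
have lo r : 0 < r -> rate p r -> rho <= r by move=> r0 rP; apply: ge_inf => //; exists 0.
have hi r : rho < r -> rate p r.
  move=> rr; have [|s [s0 sP] sr] := @inf_adherent _ S (r - rho) _ hS; first by rewrite subr_gt0.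
  by apply: rateW sP; apply/ltW; rewrite addrC subrK in sr.
exists rho; split=> //.
have sup_ge s : 0 < s -> rho < s^-1 -> ((s - 1)%:E <= exp_a Theta p)%E.
  move=> s0 sr; apply: ereal_sup_ubound; exists (s - 1) => //=.
  have si0 : 0 < s^-1 by rewrite invr_gt0.
  have sE : 1 + (s - 1) = s^-1^-1 by rewrite invrK addrC subrK.
  by have [_] := near_solvable_rate p si0 sE; apply; apply: hi.
have [rhoE|rhoN] := eqVneq rho 0.
  rewrite rhoE inve0; suff -> : exp_a Theta p = +oo%E by [].
  apply: eq_infty => t; apply: (@le_trans _ _ ((`|t| + 1 - 1)%:E)).
    by rewrite addrK lee_fin ler_norm.
  by apply: sup_ge; rewrite ?rhoE ?invr_gt0 ltr_wpDl.
have rho_gt0 : 0 < rho by rewrite lt_def rhoN.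
rewrite inver (negPf rhoN); suff -> : exp_a Theta p = (rho^-1 - 1)%:E.
  by rewrite -EFinD addrC subrK.
apply/eqP; rewrite eq_le; apply/andP; split.
  apply: ge_ereal_sup => _ [gamma /= gP <-]; rewrite lee_fin lerBrDl.
  (* Values gamma <= -1 correspond to no positive r, but they lie below rho^-1 - 1 anyway. *)
  have [g0|g0] := ltP 0 (1 + gamma); last by rewrite (le_trans g0) // invr_ge0.
  rewrite -[leLHS]invrK lef_pV2 ?posrE ?invr_gt0 //.
  have gi0 : 0 < (1 + gamma)^-1 by rewrite invr_gt0.
  apply: lo => //; have [+ _] := near_solvable_rate p gi0 (esym (invrK _)).
  exact.
apply/lee_addgt0Pr => e e0.
(* The second argument keeps s positive when e is large. *)
pose s := Num.max (rho^-1 - e) (rho^-1 / 2).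
have ri0 : 0 < rho^-1 by rewrite invr_gt0.
have s0 : 0 < s by rewrite lt_max divr_gt0 // orbT.
have sr : s < rho^-1 by rewrite gt_max; apply/andP; split; lra.
apply: (@le_trans _ _ ((s - 1)%:E + e%:E)%E); last first.
  by rewrite leeD2r // sup_ge // -[ltLHS]invrK ltf_pV2 ?posrE.
rewrite -EFinD lee_fin.
have : rho^-1 - e <= s by rewrite le_max lexx.
lra.
Qed.

End Rates.

(** * The inequalities between consecutive exponents *)

Theorem theorem2 (R : realType) (m n : nat) (Theta : 'M[R]_(n, m)) (p : nat)
    (hm : (1 <= m)%N) (hn : (1 <= n)%N) (hd : (3 <= m + n)%N)
    (hp1 : (1 <= p)%N) (hp2 : (p <= m + n - 2)%N) :
  ((m <= p)%N ->
     (((m + n)%:R - p%:R - 1)%:E * (1 + exp_a Theta p.+1)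
        >= ((m + n)%:R - p%:R)%:E * (1 + exp_a Theta p))%E)
  /\
  ((p <= m - 1)%N ->
     (((m + n)%:R - p%:R - 1)%:E * (1 + exp_a Theta p)^-1
        >= ((m + n)%:R - p%:R)%:E * (1 + exp_a Theta p.+1)^-1 - n%:R%:E)%E).
Proof.
have [q pq] : exists q, (p + q.+2 = m + n)%N by exists (m + n - p - 2)%N; lia.
have [|rho [rho0 E lo hi]] := @exp_a_rate _ _ _ Theta p; first by lia.
have [|rho' [rho0' E' lo' hi']] := @exp_a_rate _ _ _ Theta p.+1; first by lia.
(* Here q + 2 = d - p. Both cases of the theorem are rearrangements of this comparison of infimal
   rates. *)
have key : (rho' + (m - p.+1)%N%:R) * q.+2%:R <= (rho + (m - p)%N%:R) * q.+1%:R.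
  rewrite leNgt; apply/negP; rewrite -subr_gt0; set g := _ - _ => g0.
  have q0 : 0 <= q%:R :> R by [].
  (* This makes eta below at most rho' / 2, so that rho' - eta is still a positive candidate
     rate. *)
  have grho : g <= rho' * q.+2%:R.
    have : (m - p.+1)%N%:R * q.+2%:R <= (m - p)%N%:R * q.+1%:R :> R.
      rewrite -!natrM ler_nat; have [mp|pm] := leqP m p.
        by rewrite (eqP (_ : m - p.+1 == 0)%N) // subn_eq0 leqW.
      have -> : (m - p = (m - p.+1).+1)%N by lia.
      have : (m - p.+1 <= q.+1)%N by lia.
      nia.
    have := mulr_ge0 rho0 (ler0n R q.+1); rewrite /g !mulrDl; lra.
  (* Raising rho and lowering rho' by eta costs (2q + 3) eta, less than g = (2q + 4) eta. So rho' -
     eta would be a rate in degree p + 1, against the minimality of rho'. *)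
  pose eta := g / (2 * q.+2%:R).
  have eg : eta * (2 * q.+2%:R) = g by rewrite /eta divfK // mulf_neq0 // pnatr_eq0.
  have eta0 : 0 < eta by rewrite divr_gt0 // mulr_gt0.
  have etar : eta < rho'.
    rewrite -(@ltr_pM2r _ q.+2%:R) //; lra.
  have : rate Theta p.+1 (rho' - eta).
    apply: (rate_going_up (q := q.+1) pq (hi (rho + eta) _)); first by rewrite ltrDl.
    rewrite -subr_gt0 !mulrDl mulNr; move: eg; rewrite /g !mulrDl -!(natr1 q.+1).
    lra.
  by move/lo'; rewrite subr_gt0 => /(_ etar); lra.
have c1 : (m + n)%:R - p%:R = q.+2%:R :> R by rewrite -pq natrD addrC addKr.
have c2 : (m + n)%:R - p%:R - 1 = q.+1%:R :> R by rewrite c1 -[q.+2%:R]natr1 addrK.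
rewrite c2 c1 E E'; split=> [mp|pm].
  move: key; have -> : (m - p = 0)%N by lia.
  have -> : (m - p.+1 = 0)%N by lia.
  rewrite !addr0 => key.
  (* If rho' = 0, the exponent in degree p + 1 is infinite and the larger side is +oo. *)
  have [->|rN'] := eqVneq rho' 0.
    by rewrite inve0 gt0_muley ?lte_fin // leey.
  have r0' : 0 < rho' by rewrite lt_def rN'.
  have r0 : 0 < rho.
    have h := lt_le_trans (mulr_gt0 r0' (ltr0Sn R q.+1)) key.
    by rewrite pmulr_lgt0 // in h.
  rewrite !inver (negPf rN') (gt_eqF r0) -!EFinM lee_fin.
  by rewrite ler_pdivrMr // mulrAC ler_pdivlMr // mulrC [leRHS]mulrC.
(* This includes x = 0, through +oo; the second case thus becomes a linear inequality between rho
   and rho'. *)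
have iK (x : R) : ((x%:E^-1)^-1)%E = x%:E.
  have [->|x0] := eqVneq x 0; first by rewrite inve0 invey.
  by rewrite inver (negPf x0) inver invr_eq0 (negPf x0) invrK.
rewrite !iK -!EFinM -EFinB lee_fin; move: key.
have -> : (m - p = (m - p.+1).+1)%N by lia.
(* The term n is what remains of the shifts: (m - p)(d - p - 1) - (m - p - 1)(d - p) = n. *)
have : n%:R = q.+1%:R - (m - p.+1)%N%:R :> R.
  by apply/eqP; rewrite eq_sym subr_eq -natrD eqr_nat; apply/eqP; lia.
rewrite -(natr1 (m - p.+1)) -[q.+2%:R]natr1; lra.
Qed.
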